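(* The axiomatization $\mathbf{RML}$ is sound for $\mathsf{RML}$: every formula of $\mathcal L_\forall$ derivable in $\mathbf{RML}$ is valid, i.e. true at every pointed model.
   Context: Fix a finite set $A$ of agents and a countably infinite set $P$ of propositional variables. A model $M=(S,R,V)$ consists of a nonempty set $S$, relations $R_a\subseteq S\times S$ for $a\in A$, and $V:P\to\mathcal P(S)$; $sR_a=\{t\mid(s,t)\in R_a\}$. For $B\subseteq A$, a $B$-refinement between $M$ and $M'=(S',R',V')$ is a nonempty $\mathfrak F\subseteq S\times S'$ such that for all $(s,s')\in\mathfrak F$: $s\in V(p)$ iff $s'\in V'(p)$ for all $p$; for every $b\in A$ and $t'\in s'R'_b$ there is $t\in sR_b$ with $(t,t')\in\mathfrak F$; for every $b\in A\setminus B$ and $t\in sR_b$ there is $t'\in s'R'_b$ with $(t,t')\in\mathfrak F$. $M_s\succeq_a M'_{s'}$ iff some $\{a\}$-refinement contains $(s,s')$. Language $\mathcal L_\forall$: $\varphi::=p\mid\neg\varphi\mid(\varphi\wedge\varphi)\mid\Box_a\varphi\mid\forall_a\varphi$. Abbreviations: $\Diamond_a\varphi:=\neg\Box_a\neg\varphi$, $\exists_a\varphi:=\neg\forall_a\neg\varphi$, $\nabla_a\Phi:=\Box_a\bigvee\Phi\wedge\bigwedge_{\varphi\in\Phi}\Diamond_a\varphi$ for finite $\Phi$ (empty disjunction $\bot$, empty conjunction $\top$), $\exists_a\Phi:=\{\exists_a\varphi\mid\varphi\in\Phi\}$. Semantics: standard for atoms and Booleans; $M_s\models\Box_a\varphi$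 iff $M_t\models\varphi$ for all $t\in sR_a$; $M_s\models\forall_a\varphi$ iff $M'_{s'}\models\varphi$ for all $M'_{s'}$ with $M_s\succeq_a M'_{s'}$. $\mathbf{RML}$: all instances of propositional tautologies; $\Box_a(\varphi\to\psi)\to(\Box_a\varphi\to\Box_a\psi)$; $\forall_a(\varphi\to\psi)\to(\forall_a\varphi\to\forall_a\psi)$; $\forall_ap\leftrightarrow p$ and $\forall_a\neg p\leftrightarrow\neg p$ ($p\in P$); $\exists_a\nabla_a\Phi\leftrightarrow\bigwedge_{\varphi\in\Phi}\Diamond_a\exists_a\varphi$; $\exists_a\nabla_b\Phi\leftrightarrow\nabla_b\exists_a\Phi$ for $a\neq b$; $\exists_a\bigwedge_{b\in B}\nabla_b\Phi^b\leftrightarrow\bigwedge_{b\in B}\exists_a\nabla_b\Phi^b$ for $B\subseteq A$; with rules modus ponens, from $\varphi$ infer $\Box_a\varphi$, and from $\varphi$ infer $\forall_a\varphi$. *)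

(* Defs.v *)
From mathcomp Require Import all_boot.
Set Implicit Arguments.
Unset Strict Implicit.
Unset Printing Implicit Defensive.

Definition countably_infinite (P : Type) : Prop :=
  exists f : nat -> P, bijective f.

Section Language.
Variables (A : finType) (P : Type).

Inductive form : Type :=
| Var of P
| Neg of form
| And of form & form
| Box of A & form
| All of A & form.

Definition Or (phi psi : form) : form := Neg (And (Neg phi) (Neg psi)).
Definition Imp (phi psi : form) : form := Neg (And phi (Neg psi)).
Definition Iff (phi psi : form) : form := And (Imp phi psi) (Imp psi phi).
Definition Dia (a : A) (phi : form) : form := Neg (Box a (Neg phi)).
Definition Ex (a : A) (phi : form) : form := Neg (All a (Neg phi)).

(* The grammar has no primitive constant, so falsum and verum are written with
   a designated variable p0. *)
Definition Bot (p0 : P) : form := And (Var p0) (Neg (Var p0)).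
Definition Top (p0 : P) : form := Neg (Bot p0).

(* Finite sets of formulas are given by finite lists enumerating them. *)
Definition BigOr (p0 : P) (Phi : seq form) : form := foldr Or (Bot p0) Phi.
Definition BigAnd (p0 : P) (Phi : seq form) : form := foldr And (Top p0) Phi.

Definition Nabla (p0 : P) (a : A) (Phi : seq form) : form :=
  And (Box a (BigOr p0 Phi)) (BigAnd p0 [seq Dia a phi | phi <- Phi]).

Definition Exs (a : A) (Phi : seq form) : seq form :=
  [seq Ex a phi | phi <- Phi].

Record model : Type := Model {
  world : Type;
  world_nonempty : inhabited world;
  rel_of : A -> world -> world -> Prop;
  val_of : P -> world -> Prop
}.

Record refinement (B : {set A}) (M M' : model)
    (F : world M -> world M' -> Prop) : Prop := Refinement {
  refinement_nonempty : exists s s', F s s';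
  refinement_atoms : forall s s', F s s' ->
    forall p, val_of p s <-> val_of p s';
  refinement_back : forall s s', F s s' -> forall b t', rel_of b s' t' ->
    exists2 t, rel_of b s t & F t t';
  refinement_forth : forall s s', F s s' -> forall b, b \notin B ->
    forall t, rel_of b s t -> exists2 t', rel_of b s' t' & F t t'
}.

Definition refines (a : A) (M : model) (s : world M) (M' : model)
    (s' : world M') : Prop :=
  exists2 F : world M -> world M' -> Prop, refinement [set a] F & F s s'.

Fixpoint sat (phi : form) (M : model) (s : world M) {struct phi} : Prop :=
  match phi with
  | Var p => val_of p s
  | Neg psi => ~ sat psi s
  | And psi chi => sat psi s /\ sat chi s
  | Box a psi => forall t : world M, rel_of a s t -> sat psi t
  | All a psi => forall (M' : model) (s' : world M'),
      refines a s s' -> sat psi s'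
  end.

Definition valid (phi : form) : Prop :=
  forall (M : model) (s : world M), sat phi s.

Inductive pform : Type :=
| PVar of P
| PNeg of pform
| PAnd of pform & pform.

Fixpoint peval (v : P -> bool) (f : pform) : bool :=
  match f with
  | PVar p => v p
  | PNeg g => ~~ peval v g
  | PAnd g h => peval v g && peval v h
  end.

Definition tautology (f : pform) : Prop := forall v, peval v f.

Fixpoint psubst (sigma : P -> form) (f : pform) : form :=
  match f with
  | PVar p => sigma p
  | PNeg g => Neg (psubst sigma g)
  | PAnd g h => And (psubst sigma g) (psubst sigma h)
  end.

Inductive RML (p0 : P) : form -> Prop :=
| RML_taut (f : pform) (sigma : P -> form) :
    tautology f -> RML p0 (psubst sigma f)
| RML_K_box (a : A) (phi psi : form) :
    RML p0 (Imp (Box a (Imp phi psi)) (Imp (Box a phi) (Box a psi)))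
| RML_K_all (a : A) (phi psi : form) :
    RML p0 (Imp (All a (Imp phi psi)) (Imp (All a phi) (All a psi)))
| RML_atom (a : A) (p : P) :
    RML p0 (Iff (All a (Var p)) (Var p))
| RML_natom (a : A) (p : P) :
    RML p0 (Iff (All a (Neg (Var p))) (Neg (Var p)))
| RML_nabla_same (a : A) (Phi : seq form) :
    RML p0 (Iff (Ex a (Nabla p0 a Phi))
                (BigAnd p0 [seq Dia a (Ex a phi) | phi <- Phi]))
| RML_nabla_other (a b : A) (Phi : seq form) : a != b ->
    RML p0 (Iff (Ex a (Nabla p0 b Phi)) (Nabla p0 b (Exs a Phi)))
| RML_nabla_conj (a : A) (B : {set A}) (Phi : A -> seq form) :
    RML p0 (Iff (Ex a (BigAnd p0 [seq Nabla p0 b (Phi b) | b <- enum B]))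
                (BigAnd p0 [seq Ex a (Nabla p0 b (Phi b)) | b <- enum B]))
| RML_MP (phi psi : form) :
    RML p0 (Imp phi psi) -> RML p0 phi -> RML p0 psi
| RML_nec_box (a : A) (phi : form) : RML p0 phi -> RML p0 (Box a phi)
| RML_nec_all (a : A) (phi : form) : RML p0 phi -> RML p0 (All a phi).

End Language.

(* Main.v *)
Require Import Defs.
From mathcomp Require Import all_boot.
From Stdlib Require Import Classical ClassicalEpsilon.

(** Only the interaction axioms for the cover modality need an argument.  Each
    of them compares [Ex a (Nabla p0 b Phi)] at [s] with [cover a b Phi s], which
    speaks about the successors of [s] only.  To get from the latter to the
    former, pick for every relevant successor [t] and every [phi] with [Ex a phi]
    true at [t] a refinement of [t] satisfying [phi], and hang all of these
    models under a fresh root: the result refines [s], because only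
    [a]-successors may be lost.  As truth is invariant under bisimulation, the
    hanging models keep satisfying their formulas. *)

(** * Refinements, bisimulations and invariance of truth *)

Lemma refinement_comp {A : finType} {P : Type} {B C : {set A}}
    {M N K : model A P} {F : world M -> world N -> Prop}
    {G : world N -> world K -> Prop} {s t u} :
  refinement B F -> refinement C G -> F s t -> G t u ->
  refinement (B :|: C) (fun x z => exists2 y, F x y & G y z).
Proof.
move=> [_ Fat Fback Fforth] [_ Gat Gback Gforth] Fst Gtu; split.
- by exists s, u, t.
- move=> x z [y Fxy Gyz] p; have := Fat _ _ Fxy p; have := Gat _ _ Gyz p.
  tauto.
- move=> x z [y Fxy Gyz] b z' /(Gback _ _ Gyz)[y' /(Fback _ _ Fxy)[x' xx' Fx'y'] Gy'z'].
  by exists x' => //; exists y'.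
- move=> x z [y Fxy Gyz] b; rewrite in_setU negb_or => /andP[nBb nCb] x'.
  move=> /(Fforth _ _ Fxy _ nBb)[y' /(Gforth _ _ Gyz _ nCb)[z' zz' Gy'z'] Fx'y'].
  by exists z' => //; exists y'.
Qed.

Lemma refinement_eq {A : finType} {P : Type} (B : {set A}) (M : model A P) :
  refinement B (@eq (world M)).
Proof.
split.
- by have [s] := world_nonempty M; exists s, s.
- by move=> s _ <-.
- by move=> s _ <- b t; exists t.
- by move=> s _ <- b _ t; exists t.
Qed.

Lemma refines_refl {A : finType} {P : Type} (a : A) {M : model A P}
    (s : world M) : refines a s s.
Proof. by exists eq => //; exact: refinement_eq. Qed.

(** With [set0], forth is required for every agent, so such a refinement is a bisimulation; back and
    forth then swap roles. *)
Lemma refinement_set0_flip {A : finType} {P : Type} {M N : model A P}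
    {F : world M -> world N -> Prop} :
  refinement set0 F -> refinement set0 (fun y x => F x y).
Proof.
move=> [[s [t Fst]] Fat Fback Fforth]; split.
- by exists t, s.
- by move=> y x /Fat Fxy p; have := Fxy p; tauto.
- by move=> y x Fxy b x' xx'; apply: (Fforth _ _ Fxy b) xx'; rewrite inE.
- by move=> y x Fxy b _ y' yy'; apply: Fback yy'.
Qed.

(** In the case of [All a], composing a bisimulation with an [a]-refinement gives an [a]-refinement
    again, so bisimilar worlds have the same [a]-refinements. *)
Lemma sat_bisim {A : finType} {P : Type} (phi : form A P) {M N : model A P}
    {F : world M -> world N -> Prop} {s t} :
  refinement set0 F -> F s t -> sat phi s <-> sat phi t.
Proof.
elim: phi M N F s t => [p|phi IH|phi IHphi psi IHpsi|a phi IH|a phi IH] M N F s t bF Fst /=.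
- exact: refinement_atoms bF _ _ Fst p.
- by have := IH _ _ _ _ _ bF Fst; tauto.
- by have := IHphi _ _ _ _ _ bF Fst; have := IHpsi _ _ _ _ _ bF Fst; tauto.
- split=> H u.
    move=> /(refinement_back bF Fst)[v /H Hv Fvu].
    by apply/(IH _ _ _ _ _ bF Fvu).
  have na : a \notin set0 by rewrite inE.
  move=> /(refinement_forth bF Fst na)[v /H Hv Fuv].
  by apply/(IH _ _ _ _ _ bF Fuv).
- split=> H K u [G rG Gu]; apply: H.
    exists (fun x z => exists2 y, F x y & G y z); last by exists t.
    by have := refinement_comp bF rG Fst Gu; rewrite set0U.
  exists (fun x z => exists2 y, F y x & G y z); last by exists s.
  by have := refinement_comp (refinement_set0_flip bF) rG Fst Gu; rewrite set0U.
Qed.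

(** * Truth conditions of the abbreviations *)

Lemma sat_Imp {A : finType} {P : Type} (phi psi : form A P) {M : model A P}
    (s : world M) : sat (Imp phi psi) s <-> (sat phi s -> sat psi s).
Proof. by rewrite /Imp /=; tauto. Qed.

Lemma sat_Iff {A : finType} {P : Type} (phi psi : form A P) {M : model A P}
    (s : world M) : sat (Iff phi psi) s <-> (sat phi s <-> sat psi s).
Proof. by rewrite /Iff /Imp /=; tauto. Qed.

Lemma sat_Dia {A : finType} {P : Type} (a : A) (phi : form A P)
    {M : model A P} (s : world M) :
  sat (Dia a phi) s <-> exists2 t, rel_of a s t & sat phi t.
Proof.
split=> [nH|[t st phit] H]; last exact: H t st phit.
by apply: NNPP => nE; apply: nH => t st phit; apply: nE; exists t.
Qed.

Lemma sat_Ex {A : finType} {P : Type} (a : A) (phi : form A P)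
    {M : model A P} (s : world M) :
  sat (Ex a phi) s <->
  exists (N : model A P) (t : world N), refines a s t /\ sat phi t.
Proof.
split=> [nH|[N [t [st phit]]] H]; last exact: H N t st phit.
by apply: NNPP => nE; apply: nH => N t st phit; apply: nE; exists N, t.
Qed.

Lemma sat_Top {A : finType} {P : Type} (p0 : P) {M : model A P}
    (s : world M) : sat (Top A p0) s.
Proof. by rewrite /Top /=; tauto. Qed.

Lemma sat_BigOr {A : finType} {P : Type} (p0 : P) (Phi : seq (form A P))
    {M : model A P} (s : world M) :
  sat (BigOr p0 Phi) s <-> exists2 phi, List.In phi Phi & sat phi s.
Proof.
elim: Phi => [|phi Phi IH] /=; first by split=> [|[]//]; tauto.
split=> [H|[psi [<-|inPhi] Hs]]; last 1 first.
- have : sat (BigOr p0 Phi) s by apply/IH; exists psi.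
  tauto.
- case: (classic (sat phi s)) => [?|nphi]; first by exists phi => //; left.
  have /IH[psi ? ?] : sat (BigOr p0 Phi) s by apply: NNPP; tauto.
  by exists psi => //; right.
- tauto.
Qed.

Lemma sat_BigAnd_map {A : finType} {P T : Type} (p0 : P) (f : T -> form A P)
    (l : seq T) {M : model A P} (s : world M) :
  sat (BigAnd p0 [seq f x | x <- l]) s <-> forall x, List.In x l -> sat (f x) s.
Proof.
elim: l => [|x l IH] /=; first by split=> // _; apply: sat_Top.
split=> [[fx /IH fl] y [<-//|/fl//]|H]; split; first by apply: H; left.
by apply/IH => y yl; apply: H; right.
Qed.

Lemma sat_BigAnd_enum {A : finType} {P : Type} (p0 : P) (f : A -> form A P)
    (B : {set A}) {M : model A P} (s : world M) :
  sat (BigAnd p0 [seq f b | b <- enum B]) s <-> forall b, b \in B -> sat (f b) s.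
Proof.
(* Formulas carry no decidable equality, hence [List.In] for lists of them; for agents it agrees
   with boolean membership. *)
have In_mem (l : seq A) b : List.In b l <-> b \in l.
  elim: l => [|c l IH] //=; rewrite inE; split.
    by case=> [->|/IH ->]; rewrite ?eqxx ?orbT.
  by case/orP => [/eqP->|/IH]; [left|right].
rewrite sat_BigAnd_map; split=> [H b bB|H b].
  by apply: H; apply/In_mem; rewrite mem_enum.
by move/In_mem; rewrite mem_enum; apply: H.
Qed.

Lemma sat_Nabla {A : finType} {P : Type} (p0 : P) (b : A)
    (Phi : seq (form A P)) {M : model A P} (s : world M) :
  sat (Nabla p0 b Phi) s <->
  (forall t, rel_of b s t -> exists2 phi, List.In phi Phi & sat phi t) /\
  (forall phi, List.In phi Phi -> exists2 t, rel_of b s t & sat phi t).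
Proof.
have -> : sat (Nabla p0 b Phi) s <->
    (forall t, rel_of b s t -> sat (BigOr p0 Phi) t) /\
    sat (BigAnd p0 [seq Dia b phi | phi <- Phi]) s by [].
rewrite sat_BigAnd_map; split=> -[Hor Hand].
  by split=> [t /Hor /sat_BigOr//|phi /Hand /sat_Dia].
by split=> [t /Hor /sat_BigOr//|phi /Hand /sat_Dia].
Qed.

(** * Gluing models under a fresh root *)

Definition glue_rel {A : finType} {P I : Type} (act : I -> A)
    (N : I -> model A P) (pt : forall i, world (N i)) (b : A)
    (x y : option {i : I & world (N i)}) : Prop :=
  match x, y with
  | _, None => False
  | None, Some v => act (projT1 v) = b /\ v = existT _ (projT1 v) (pt (projT1 v))
  | Some u, Some v => exists e : projT1 u = projT1 v,
      rel_of b (eq_rect _ (fun i => world (N i)) (projT2 u) _ e) (projT2 v)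
  end.

(* The disjoint union of the [N i] with a fresh root [None], whose valuation is
   [rv] and which has an [act i]-edge to [pt i] for every [i]. *)
Definition glue {A : finType} {P I : Type} (act : I -> A)
    (N : I -> model A P) (pt : forall i, world (N i)) (rv : P -> Prop) :
    model A P :=
  {| world := option {i : I & world (N i)};
     world_nonempty := inhabits None;
     rel_of := glue_rel act N pt;
     val_of := fun p x => if x is Some u then val_of p (projT2 u) else rv p |}.

(** Edges leaving a world of a component stay in that component, so the inclusion of the component
    is a bisimulation. *)
Lemma sat_glue {A : finType} {P I : Type} (act : I -> A)
    (N : I -> model A P) (pt : forall i, world (N i)) (rv : P -> Prop)
    (i : I) (x : world (N i)) (phi : form A P) :
  sat phi (M := glue act N pt rv) (Some (existT _ i x)) <-> sat phi x.
Proof.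
pose F (y : world (glue act N pt rv)) (x : world (N i)) :=
  y = Some (existT _ i x).
apply: (@sat_bisim _ _ _ _ _ F) => //; split.
- by exists (Some (existT _ i x)), x.
- by move=> _ y ->.
- by move=> _ y -> b z yz; exists (Some (existT _ i z)) => //; exists erefl.
- move=> _ y -> b _ [[j z]|] //= [e]; case: j / e z => z /= yz.
  by exists z.
Qed.

Lemma refines_glue {A : finType} {P I : Type} (a : A) (M : model A P)
    (s : world M) (act : I -> A) (tgt : I -> world M) (N : I -> model A P)
    (pt : forall i, world (N i)) :
  (forall i, rel_of (act i) s (tgt i)) ->
  (forall i, refines a (tgt i) (pt i)) ->
  (forall b t, b != a -> rel_of b s t -> exists2 i, act i = b & tgt i = t) ->
  refines a s (M' := glue act N pt (fun p => val_of p s)) None.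
Proof.
move=> stgt ref cov.
(* Below the root, [refines a] itself serves: it is the union of all [a]-refinements, so back and
   forth are inherited from whichever one relates the pair. *)
pose F (x : world M) (y : world (glue act N pt (fun p => val_of p s))) :=
  match y with
  | None => x = s
  | Some u => refines a x (projT2 u)
  end.
exists F => //; split.
- by exists s, None.
- by move=> x [[i y] [G rG Gxy]|->] p //; apply: (refinement_atoms rG Gxy).
- move=> x [[i y]|] /= Fxy b [v|] //.
    case: v => j z [/= e]; case: j / e z => z /= yz.
    case: Fxy => G rG Gxy; have [w xw Gwz] := refinement_back rG Gxy yz.
    by exists w => //; exists G.
  by move=> [<- ->]; exists (tgt (projT1 v)); rewrite ?Fxy //; apply: ref.
- move=> x [[i y]|] /= Fxy b nb t xt.
    case: Fxy => G rG Gxy; have [w yw Gtw] := refinement_forth rG Gxy nb xt.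
    by exists (Some (existT _ i w)); [exists erefl|exists G].
  rewrite inE in nb; rewrite Fxy in xt; have [i <- <-] := cov _ _ nb xt.
  by exists (Some (existT _ i (pt i))); last exact: ref.
Qed.

(** [W b t phi] is a request: the new root should get a [b]-successor that refines [t] and satisfies
    [phi]. Every [b]-successor with [b != a] must occur in some request, or forth would fail at the
    root. *)
Lemma refines_realize {A : finType} {P : Type} (a : A) (M : model A P)
    (s : world M) (W : A -> world M -> form A P -> Prop) :
  (forall b t phi, W b t phi -> rel_of b s t /\ sat (Ex a phi) t) ->
  (forall b t, b != a -> rel_of b s t -> exists phi, W b t phi) ->
  exists (N : model A P) (s' : world N), [/\ refines a s s',
    forall b t phi, W b t phi -> exists2 t', rel_of b s' t' & sat phi t' &
    forall b t', rel_of b s' t' -> exists t phi, W b t phi /\ sat phi t'].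
Proof.
move=> HW cov.
(* One component per request, so a single successor [t] may be split into several. *)
pose I := {i : A * world M * form A P | W i.1.1 i.1.2 i.2}.
pose target (i : I) := (sval i).1.2.
have wit (i : I) : {N : {N : model A P & world N} |
    refines a (target i) (projT2 N) /\ sat (sval i).2 (projT2 N)}.
  apply: constructive_indefinite_description.
  have [_ /sat_Ex[N [t H]]] := HW _ _ _ (svalP i).
  by exists (existT _ N t).
pose act (i : I) := (sval i).1.1.
pose pt (i : I) := projT2 (sval (wit i)).
exists (glue act _ pt (fun p => val_of p s)), None; split.
- apply: (refines_glue _ _ _ _ target) => [i|i|b t ba st].
  + by have [] := HW _ _ _ (svalP i).
  + by have [] := svalP (wit i).
  + by have [phi Wphi] := cov b t ba st; exists (exist _ (b, t, phi) Wphi).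
- move=> b t phi Wphi; pose i : I := exist _ (b, t, phi) Wphi.
  exists (Some (existT _ i (pt i))) => //.
  by apply/sat_glue; have [] := svalP (wit i).
- move=> b [v|] //= [<- ->]; set i := projT1 v; exists (target i), (sval i).2.
  split; first exact: svalP i.
  by apply/sat_glue; have [] := svalP (wit i).
Qed.

(** * The cover modality under a refinement quantifier *)

Definition cover {A : finType} {P : Type} (a b : A) (Phi : seq (form A P))
    {M : model A P} (s : world M) : Prop :=
  (forall phi, List.In phi Phi ->
     exists2 t, rel_of b s t & sat (Ex a phi) t) /\
  (b != a -> forall t, rel_of b s t ->
     exists2 phi, List.In phi Phi & sat (Ex a phi) t).

(** Back traces each witness for a member of [Phi] to a successor of [s]; forth, available when
    [b != a], sends each successor of [s] to one satisfying a member of [Phi]. *)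
Lemma cover_of_Ex_Nabla {A : finType} {P : Type} (p0 : P) (a b : A)
    (Phi : seq (form A P)) {M : model A P} (s : world M) :
  sat (Ex a (Nabla p0 b Phi)) s -> cover a b Phi s.
Proof.
move=> /sat_Ex[N [s' [[F rF Fss'] /sat_Nabla[Hall Hex]]]]; split.
- move=> phi /Hex[t' st' phit'].
  have [t st Ftt'] := refinement_back rF Fss' st'; exists t => //.
  by apply/sat_Ex; exists N, t'; split=> //; exists F.
- move=> ba t st; rewrite -in_set1 in ba.
  have [t' /Hall[phi inPhi phit'] Ftt'] := refinement_forth rF Fss' ba st.
  by exists phi => //; apply/sat_Ex; exists N, t'; split=> //; exists F.
Qed.

(** Requests for different agents concern different edges at the root, so one gluing serves all of
    [B]. This is what the conjunction axiom rests on; a singleton [B] handles a single cover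
    modality. *)
Lemma realize_covers {A : finType} {P : Type} (p0 : P) (a : A) (B : {set A})
    (Phi : A -> seq (form A P)) {M : model A P} (s : world M) :
  (forall b, b \in B -> cover a b (Phi b) s) ->
  exists (N : model A P) (s' : world N),
    refines a s s' /\ forall b, b \in B -> sat (Nabla p0 b (Phi b)) s'.
Proof.
move=> HB; have ExTop t : sat (M := M) (Ex a (Top A p0)) t.
  by apply/sat_Ex; exists M, t; split; [exact: refines_refl|exact: sat_Top].
(* Agents outside [B] must keep their successors, unconstrained. *)
pose wanted b := if b \in B then Phi b else [:: Top A p0].
pose W b t phi :=
  [/\ rel_of b s t, sat (Ex a phi) t & List.In phi (wanted b)].
have [b t phi []//|b t ba st|N [s' [ss' Hex Hall]]] := refines_realize a M s W.
  rewrite /W /wanted; case: ifP => [/HB[_ /(_ ba _ st)[phi]]|_].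
    by exists phi.
  by exists (Top A p0); split=> //; left.
exists N, s'; split=> // b bB; have wE : wanted b = Phi b by rewrite /wanted bB.
apply/sat_Nabla; split=> [t' /Hall[t [phi [[_ _]]]]|phi inPhi].
  by rewrite wE; exists phi.
have [t st Ephi] := (HB b bB).1 phi inPhi.
by apply: (Hex b t); split; rewrite ?wE.
Qed.

Lemma sat_Ex_Nabla {A : finType} {P : Type} (p0 : P) (a b : A)
    (Phi : seq (form A P)) {M : model A P} (s : world M) :
  sat (Ex a (Nabla p0 b Phi)) s <-> cover a b Phi s.
Proof.
split=> [|H]; first exact: cover_of_Ex_Nabla.
have [c|N [s' [ss' HN]]] := realize_covers p0 a [set b] (fun=> Phi) s.
  by rewrite inE => /eqP->.
by apply/sat_Ex; exists N, s'; split=> //; apply: HN; rewrite inE.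
Qed.

(** * Validity of the axioms and soundness *)

Lemma sat_psubst {A : finType} {P : Type} (sigma : P -> form A P)
    {M : model A P} (s : world M) (v : P -> bool) (f : pform P) :
  (forall p, reflect (sat (sigma p) s) (v p)) ->
  reflect (sat (psubst sigma f) s) (peval v f).
Proof.
move=> Hv; elim: f => [p|f IH|f IHf g IHg] //=.
- by apply: (iffP negP) => H /IH.
- by apply: (iffP andP) => -[/IHf ? /IHg ?].
Qed.

Lemma valid_psubst {A : finType} {P : Type} (sigma : P -> form A P)
    (f : pform P) : tautology f -> valid (psubst sigma f).
Proof.
move=> taut M s.
(* Excluded middle turns truth at [s] into a boolean valuation, to which [tautology] applies. *)
pose v p : bool := excluded_middle_informative (sat (sigma p) s).
by apply/(sat_psubst sigma s v) => [p|]; [exact: sumboolP|exact: taut].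
Qed.

(** For [b = a] the second clause of [cover] is vacuous, and the first is the conjunction of
    diamonds. *)
Lemma valid_Nabla_same {A : finType} {P : Type} (p0 : P) (a : A)
    (Phi : seq (form A P)) :
  valid (Iff (Ex a (Nabla p0 a Phi))
             (BigAnd p0 [seq Dia a (Ex a phi) | phi <- Phi])).
Proof.
move=> M s; apply/sat_Iff; split.
  move=> /sat_Ex_Nabla[Hex _]; apply/sat_BigAnd_map => phi /Hex.
  by move/sat_Dia.
move=> /sat_BigAnd_map H; apply/sat_Ex_Nabla; split; last by rewrite eqxx.
by move=> phi /H /sat_Dia.
Qed.

Lemma valid_Nabla_other {A : finType} {P : Type} (p0 : P) (a b : A)
    (Phi : seq (form A P)) :
  a != b ->
  valid (Iff (Ex a (Nabla p0 b Phi)) (Nabla p0 b (Exs a Phi))).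
Proof.
rewrite eq_sym => ba M s; apply/sat_Iff; split.
  move=> /sat_Ex_Nabla[Hex /(_ ba) Hall]; apply/sat_Nabla; split.
    move=> t /Hall[phi inPhi ?]; exists (Ex a phi) => //.
    exact: List.in_map.
  by move=> _ /List.in_map_iff[phi [<- /Hex]].
move=> /sat_Nabla[Hall Hex]; apply/sat_Ex_Nabla; split.
  by move=> phi inPhi; apply: Hex; exact: List.in_map.
by move=> _ t /Hall[_ /List.in_map_iff[phi [<- inPhi]] ?]; exists phi.
Qed.

Lemma valid_Nabla_conj {A : finType} {P : Type} (p0 : P) (a : A)
    (B : {set A}) (Phi : A -> seq (form A P)) :
  valid (Iff (Ex a (BigAnd p0 [seq Nabla p0 b (Phi b) | b <- enum B]))
             (BigAnd p0 [seq Ex a (Nabla p0 b (Phi b)) | b <- enum B])).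
Proof.
move=> M s; apply/sat_Iff; split.
  move=> /sat_Ex[N [s' [ss' /sat_BigAnd_enum H]]].
  by apply/sat_BigAnd_enum => b /H ?; apply/sat_Ex; exists N, s'.
move=> /sat_BigAnd_enum H.
have [b /H /sat_Ex_Nabla//|N [s' [ss' HN]]] := realize_covers p0 a B Phi s.
by apply/sat_Ex; exists N, s'; split=> //; apply/sat_BigAnd_enum.
Qed.

Theorem theorem1 (A : finType) (P : Type) (hP : countably_infinite P) (p0 : P)
    (phi : form A P) :
  RML p0 phi -> valid phi.
Proof.
elim=> {phi}.
- by move=> f sigma; exact: valid_psubst.
- move=> a phi psi M s; apply/sat_Imp => H; apply/sat_Imp => Hphi t st.
  by move/sat_Imp: (H t st); apply; exact: Hphi.
- move=> a phi psi M s; apply/sat_Imp => H; apply/sat_Imp => Hphi N t st.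
  by move/sat_Imp: (H N t st); apply; exact: Hphi.
(* Every pointed model refines itself, which gives one direction; refinements preserve atoms, which
   gives the other. *)
- move=> a p M s; apply/sat_Iff; split=> [/(_ M s (refines_refl a s))//|].
  by move=> ps N t [F rF Fst]; apply/(refinement_atoms rF Fst).
- move=> a p M s; apply/sat_Iff; split=> [/(_ M s (refines_refl a s))//|].
  by move=> nps N t [F rF Fst] /(refinement_atoms rF Fst).
- by move=> a Phi; exact: valid_Nabla_same.
- by move=> a b Phi; exact: valid_Nabla_other.
- by move=> a B Phi; exact: valid_Nabla_conj.
- by move=> phi psi _ Himp _ Hphi M s; move/sat_Imp: (Himp M s); apply.
- by move=> a phi _ H M s t _; exact: H.
- by move=> a phi _ H M s N t _; exact: H.
Qed.
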